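(* Let $\mathfrak{g}$ and $\mathfrak{h}$ be two Leibniz algebras. A Leibniz algebra $\Xi$ factorizes through $\mathfrak{g}$ and $\mathfrak{h}$ if and only if there exists a matched pair of Leibniz algebras $(\mathfrak{g},\mathfrak{h},\triangleleft,\triangleright,\leftharpoonup,\rightharpoonup)$ such that $\Xi\cong\mathfrak{g}\bowtie\mathfrak{h}$ as Leibniz algebras.
   Context: All vector spaces, linear and bilinear maps are over an arbitrary field $k$. A Leibniz algebra is a vector space $\mathfrak{g}$ with a bilinear map $[-,-]$ satisfying $[g,[h,l]]=[[g,h],l]-[[g,l],h]$. $\Xi$ factorizes through $\mathfrak{g}$ and $\mathfrak{h}$ if $\Xi$ contains (isomorphic copies of) $\mathfrak{g}$ and $\mathfrak{h}$ as Leibniz subalgebras such that $\Xi=\mathfrak{g}+\mathfrak{h}$ and $\mathfrak{g}\cap\mathfrak{h}=\{0\}$. A matched pair of Leibniz algebras is a system $(\mathfrak{g},\mathfrak{h},\triangleleft,\triangleright,\leftharpoonup,\rightharpoonup)$ consisting of two Leibniz algebras $(\mathfrak{g},[-,-])$, $(\mathfrak{h},\{-,-\})$ and four bilinear maps $\triangleleft:\mathfrak{h}\times\mathfrak{g}\to\mathfrak{h}$, $\triangleright:\mathfrak{h}\times\mathfrak{g}\to\mathfrak{g}$, $\leftharpoonup:\mathfrak{g}\times\mathfrak{h}\to\mathfrak{g}$, $\rightharpoonup:\mathfrak{g}\times\mathfrak{h}\to\mathfrak{h}$ such that for all $g,h\in\mathfrak{g}$, $x,y\in\mathfrak{h}$: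 (MP1) $x\triangleleft[g,h]=(x\triangleleft g)\triangleleft h-(x\triangleleft h)\triangleleft g$; (MP2) $g\leftharpoonup\{x,y\}=(g\leftharpoonup x)\leftharpoonup y-(g\leftharpoonup y)\leftharpoonup x$; (MP3) $x\triangleright[g,h]=[x\triangleright g,h]-[x\triangleright h,g]+(x\triangleleft g)\triangleright h-(x\triangleleft h)\triangleright g$; (MP4) $\{x,y\}\triangleleft g=x\triangleleft(y\triangleright g)+(x\triangleright g)\rightharpoonup y+\{x,y\triangleleft g\}+\{x\triangleleft g,y\}$; (MP5) $\{x,y\}\triangleright g=x\triangleright(y\triangleright g)+(x\triangleright g)\leftharpoonup y$; (MP6) $[g,h]\leftharpoonup x=[g,h\leftharpoonup x]+[g\leftharpoonup x,h]+g\leftharpoonup(h\rightharpoonup x)+(g\rightharpoonup x)\triangleright h$; (MP7) $[g,h]\rightharpoonup x=g\rightharpoonup(h\rightharpoonup x)+(g\rightharpoonup x)\triangleleft h$; (MP8) $g\rightharpoonup\{x,y\}=(g\leftharpoonup x)\rightharpoonup y-(g\leftharpoonup y)\rightharpoonup x+\{g\rightharpoonup x,y\}-\{g\rightharpoonup y,x\}$; (MP9) $[g,h\leftharpoonup x]+[g,x\triangleright h]+g\leftharpoonup(h\rightharpoonup x)+g\leftharpoonup(x\triangleleft h)=0$; (MP10) $x\triangleright(y\triangleright g)+x\triangleright(g\leftharpoonup y)=0$; (MP11) $x\triangleleft(y\triangleright g)+x\triangleleft(g\leftharpoonup y)+\{x,y\triangleleft g\}+\{x,g\rightharpoonup y\}=0$;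 (MP12) $g\rightharpoonup(h\rightharpoonup x)+g\rightharpoonup(x\triangleleft h)=0$. The bicrossed product $\mathfrak{g}\bowtie\mathfrak{h}$ is the Leibniz algebra $\mathfrak{g}\times\mathfrak{h}$ with bracket $[(g,x),(h,y)]=([g,h]+x\triangleright h+g\leftharpoonup y,\ \{x,y\}+x\triangleleft h+g\rightharpoonup y)$. *)

(* Defs.v *)
From HB Require Import structures.
From mathcomp Require Import all_boot all_order all_algebra.
From mathcomp Require Import sesquilinear.

Set Implicit Arguments.
Unset Strict Implicit.
Unset Printing Implicit Defensive.

Import GRing.Theory.
Local Open Scope ring_scope.

Declare Scope leibniz_scope.
Delimit Scope leibniz_scope with L.
Local Open Scope leibniz_scope.

(* The identity below says that right multiplications are derivations
   (right Leibniz algebras); no antisymmetry is required. *)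
HB.mixin Record isLeibniz (k : fieldType) V of GRing.Lmodule k V := {
  bracket : V -> V -> V;
  bracket_bilinear : bilinear_for *:%R *:%R bracket;
  bracket_leibniz : forall x y z : V,
    bracket x (bracket y z) =
      bracket (bracket x y) z - bracket (bracket x z) y
}.

#[short(type="leibnizType")]
HB.structure Definition Leibniz (k : fieldType) :=
  { V of isLeibniz k V & GRing.Lmodule k V }.

Notation "⟦ x , y ⟧" := (bracket x y)
  (at level 0, x at level 99, y at level 99, format "⟦ x ,  y ⟧")
  : leibniz_scope.

HB.instance Definition _ (k : fieldType) (V : leibnizType k) :=
  bilinear_isBilinear.Build k V V V *:%R *:%R (@bracket k V)
    (@bracket_bilinear k V).

Definition leibniz_morph (k : fieldType) (A B : leibnizType k) (f : A -> B) :=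
  {morph f : x y / ⟦x, y⟧}.

Definition leibniz_iso (k : fieldType) (A B : leibnizType k) : Prop :=
  exists f : {linear A -> B}, leibniz_morph f /\ bijective f.

(* Subspaces are boolean predicates, as elsewhere in the library.  This is no
   restriction for factorizations: if [X] is the direct sum of the copies of [g]
   and [h], membership in either copy is decided by a zero test on one of the
   two components. *)
Definition leibniz_subalgebra (k : fieldType) (X : leibnizType k)
    (S : {pred X}) : Prop :=
  submod_closed S /\ {in S &, forall x y, ⟦x, y⟧ \in S}.

(* [S] is isomorphic to [A]: the isomorphism [A -> S] is given as an injective
   morphism into the ambient algebra [X] with image [S]. *)
Definition isomorphic_copy (k : fieldType) (A X : leibnizType k)
    (S : {pred X}) : Prop :=
  exists f : {linear A -> X},
    [/\ leibniz_morph f, injective f &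
        forall z : X, z \in S <-> exists a : A, f a = z].

Definition factorizes_through (k : fieldType) (X g h : leibnizType k) : Prop :=
  exists G H : {pred X},
    [/\ leibniz_subalgebra G /\ isomorphic_copy g G,
        leibniz_subalgebra H /\ isomorphic_copy h H,
        (forall z : X, exists a b : X, [/\ a \in G, b \in H & z = a + b]) &
        (forall z : X, z \in G /\ z \in H <-> z = 0)].

Section MatchedPair.
Variables (k : fieldType) (g h : leibnizType k).

Section Identities.
Variables (lhd : {bilinear h -> g -> h}) (rhd : {bilinear h -> g -> g})
          (lharp : {bilinear g -> h -> g}) (rharp : {bilinear g -> h -> h}).

Local Notation "x ◁ a" := (lhd x a) (at level 40, left associativity).
Local Notation "x ▷ a" := (rhd x a) (at level 40, left associativity).
Local Notation "a ↼ x" := (lharp a x) (at level 40, left associativity).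
Local Notation "a ⇀ x" := (rharp a x) (at level 40, left associativity).

Record matched_pair_identities : Prop := MatchedPairIdentities {
  MP1 : forall (a b : g) (x : h),
    x ◁ ⟦a, b⟧ = (x ◁ a) ◁ b - (x ◁ b) ◁ a;
  MP2 : forall (a : g) (x y : h),
    a ↼ ⟦x, y⟧ = (a ↼ x) ↼ y - (a ↼ y) ↼ x;
  MP3 : forall (a b : g) (x : h),
    x ▷ ⟦a, b⟧ = ⟦x ▷ a, b⟧ - ⟦x ▷ b, a⟧ + (x ◁ a) ▷ b - (x ◁ b) ▷ a;
  MP4 : forall (a : g) (x y : h),
    ⟦x, y⟧ ◁ a = x ◁ (y ▷ a) + (x ▷ a) ⇀ y + ⟦x, y ◁ a⟧ + ⟦x ◁ a, y⟧;
  MP5 : forall (a : g) (x y : h),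
    ⟦x, y⟧ ▷ a = x ▷ (y ▷ a) + (x ▷ a) ↼ y;
  MP6 : forall (a b : g) (x : h),
    ⟦a, b⟧ ↼ x = ⟦a, b ↼ x⟧ + ⟦a ↼ x, b⟧ + a ↼ (b ⇀ x) + (a ⇀ x) ▷ b;
  MP7 : forall (a b : g) (x : h),
    ⟦a, b⟧ ⇀ x = a ⇀ (b ⇀ x) + (a ⇀ x) ◁ b;
  MP8 : forall (a : g) (x y : h),
    a ⇀ ⟦x, y⟧ = (a ↼ x) ⇀ y - (a ↼ y) ⇀ x + ⟦a ⇀ x, y⟧ - ⟦a ⇀ y, x⟧;
  MP9 : forall (a b : g) (x : h),
    ⟦a, b ↼ x⟧ + ⟦a, x ▷ b⟧ + a ↼ (b ⇀ x) + a ↼ (x ◁ b) = 0;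
  MP10 : forall (a : g) (x y : h),
    x ▷ (y ▷ a) + x ▷ (a ↼ y) = 0;
  MP11 : forall (a : g) (x y : h),
    x ◁ (y ▷ a) + x ◁ (a ↼ y) + ⟦x, y ◁ a⟧ + ⟦x, a ⇀ y⟧ = 0;
  MP12 : forall (a b : g) (x : h),
    a ⇀ (b ⇀ x) + a ⇀ (x ◁ b) = 0
}.
End Identities.

Record matched_pair := MatchedPair {
  lhd : {bilinear h -> g -> h};
  rhd : {bilinear h -> g -> g};
  lharp : {bilinear g -> h -> g};
  rharp : {bilinear g -> h -> h};
  matched_pairP : matched_pair_identities lhd rhd lharp rharp
}.

End MatchedPair.

Definition bicrossed (k : fieldType) (g h : leibnizType k)
  (M : matched_pair g h) : Type := (g * h)%type.

Section Bicrossed.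
Variables (k : fieldType) (g h : leibnizType k) (M : matched_pair g h).

HB.instance Definition _ := GRing.Lmodule.copy (bicrossed M) (g * h)%type.

Definition bicrossed_bracket (u v : bicrossed M) : bicrossed M :=
  (⟦u.1, v.1⟧ + rhd M u.2 v.1 + lharp M u.1 v.2,
   ⟦u.2, v.2⟧ + lhd M u.2 v.1 + rharp M u.1 v.2).

Lemma bicrossed_bilinear : bilinear_for *:%R *:%R bicrossed_bracket.
Proof.
by split=> [v|u] a [x1 x2] [y1 y2]; congr pair => /=;
  rewrite ?linearPl ?linearPr /= !scalerDr
    [RHS]addrACA [X in _ = X + _]addrACA.
Qed.

Let inG (a : g) : bicrossed M := (a, 0).
Let inH (x : h) : bicrossed M := (0, x).
Local Notation B := bicrossed_bracket.
Let J (u v w : bicrossed M) : bicrossed M := B u (B v w) - (B (B u v) w - B (B u w) v).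

Let pe (p q : bicrossed M) : p.1 = q.1 -> p.2 = q.2 -> p = q.
Proof. by case: p q => [p1 p2] [q1 q2] /= -> ->. Qed.

Let splitE (u : bicrossed M) : u = inG u.1 + inH u.2.
Proof. by apply: pe; [exact: esym (addr0 _) | exact: esym (add0r _)]. Qed.

Let BDl (v u u' : bicrossed M) : B (u + u') v = B u v + B u' v.
Proof.
have := bicrossed_bilinear.1 v 1 u u'; rewrite scale1r => ->.
by congr (_ + _); apply: scale1r.
Qed.

Let BDr (u v v' : bicrossed M) : B u (v + v') = B u v + B u v'.
Proof.
have := bicrossed_bilinear.2 u 1 v v'; rewrite scale1r => ->.
by congr (_ + _); apply: scale1r.
Qed.

Let addJ1 v w u u' : J (u + u') v w = J u v w + J u' v w.
Proof.
by rewrite /J !(BDl, BDr) !opprB opprD [X in _ + X = _]addrACA [LHS]addrACA.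
Qed.

Let addJ2 u w v v' : J u (v + v') w = J u v w + J u v' w.
Proof.
by rewrite /J !(BDl, BDr) !opprB opprD [X in _ + X = _]addrACA [LHS]addrACA.
Qed.

Let addJ3 u v w w' : J u v (w + w') = J u v w + J u v w'.
Proof.
by rewrite /J !(BDl, BDr) !opprB opprD [X in _ + X = _]addrACA [LHS]addrACA.
Qed.

Lemma bicrossed_leibniz u v w : B u (B v w) = B (B u v) w - B (B u w) v.
Proof.
apply/eqP; rewrite -subr_eq0 -/(J u v w).
rewrite (splitE u) (splitE v) (splitE w).
move: u.1 u.2 v.1 v.2 w.1 w.2 => a x b y c z.
have P := matched_pairP M.
have sum0 (p q : bicrossed M) : p = 0 -> q = 0 -> p + q = 0.
  by move=> -> ->; rewrite addr0.
rewrite !addJ1 !addJ2 !addJ3; apply/eqP.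
do 3 !apply: (sum0); apply/eqP; rewrite subr_eq0; apply/eqP; apply: pe;
  rewrite /= ?(linear0l, linear0r, addr0, add0r, subr0, sub0r).
- exact: bracket_leibniz.
- by rewrite ?linear0l ?linear0r oppr0.
- by rewrite (MP6 P) -[X in X - _]addrA [X in X - _]addrACA addrK.
- by rewrite (MP7 P) addrK.
- rewrite (MP6 P) -[X in _ - X]addrA [X in _ - X]addrACA opprD [RHS]addrC subrK.
  by apply/esym/addr0_eq; rewrite addrACA addrA (MP9 P).
- rewrite (MP7 P) opprD [RHS]addrC subrK.
  by apply/esym/addr0_eq/(MP12 P).
- exact: MP2 P _ _ _.
- rewrite (MP8 P) -[LHS]addrA [LHS]addrACA -opprD.
  by congr (_ - _); rewrite addrC.
- by rewrite (MP3 P) -[LHS]addrA [LHS]addrACA -opprD.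
- exact: MP1 P _ _ _.
- rewrite (MP5 P) opprD [RHS]addrC subrK.
  by apply/esym/addr0_eq/(MP10 P).
- rewrite (MP4 P) -[X in _ - X]addrA [X in _ - X]addrACA opprD.
  rewrite [X in _ = X + _]addrC [RHS]addrC subrK.
  apply/esym/addr0_eq; rewrite [X in _ + X]addrC.
  by rewrite addrACA addrA (MP11 P).
- by rewrite (MP5 P) addrK.
- rewrite (MP4 P) -[X in X - _]addrA [X in X - _]addrACA.
  rewrite [X in _ - X]addrC addrK.
  exact: addrC.
- by rewrite ?linear0l ?linear0r oppr0.
- exact: bracket_leibniz.
Qed.


HB.instance Definition _ :=
  isLeibniz.Build k (bicrossed M) bicrossed_bilinear bicrossed_leibniz.

End Bicrossed.

(* Main.v *)
(** If [Xi] is the direct sum of copies [i g] and [j h], the four actions are the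
    components of the mixed brackets [⟦i a, j x⟧] and [⟦j x, i a⟧] along this
    decomposition.  The Leibniz identity in [Xi] is equivalent to the pair
    [⟦⟦u, v⟧, w⟧ = ⟦u, ⟦v, w⟧⟧ + ⟦⟦u, w⟧, v⟧] and
    [⟦u, ⟦v, w⟧⟧ + ⟦u, ⟦w, v⟧⟧ = 0]; projecting these onto [g] and [h], with one
    or two of the arguments in each copy, gives (MP1)-(MP12). *)
Require Import Defs.
From HB Require Import structures.
From mathcomp Require Import all_boot all_algebra.
From mathcomp Require Import sesquilinear.

Set Implicit Arguments.
Unset Strict Implicit.
Unset Printing Implicit Defensive.

Import GRing.Theory.
Local Open Scope ring_scope.
Local Open Scope leibniz_scope.

(** * Rearrangements of the Leibniz identity *)

Section LeibnizIdentities.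
Variables (k : fieldType) (X : leibnizType k).
Implicit Types u v w : X.

Lemma bracketDl w : {morph (fun u => ⟦u, w⟧) : u v / u + v}.
Proof. exact: linearDl. Qed.

Lemma bracketDr u : {morph bracket u : v w / v + w}.
Proof. exact: linearDr. Qed.

Lemma bracket_bracketl u v w : ⟦⟦u, v⟧, w⟧ = ⟦u, ⟦v, w⟧⟧ + ⟦⟦u, w⟧, v⟧.
Proof. by rewrite (bracket_leibniz u v w) subrK. Qed.

(** Expanded by the Leibniz identity, the two terms are opposite differences. This replaces
    antisymmetry, but only inside a right argument. *)
Lemma bracket_anti_r u v w : ⟦u, ⟦v, w⟧⟧ + ⟦u, ⟦w, v⟧⟧ = 0.
Proof. by rewrite !(bracket_leibniz u) addrC subrKA subrr. Qed.

End LeibnizIdentities.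

Lemma bijective_linear_inv (k : fieldType) (U V : lmodType k)
    (f : {linear U -> V}) :
  bijective f -> exists e : {linear V -> U}, cancel f e /\ cancel e f.
Proof.
case=> e fK eK; have e_lin := can2_linear fK eK.
pose eM := GRing.isLinear.Build k V U *:%R e e_lin.
pose eL : {linear V -> U} := HB.pack e eM.
by exists eL.
Qed.

(** * From a direct sum decomposition to a matched pair *)

Section Decomposition.
Variables (k : fieldType) (g h X : leibnizType k).
Variables (i : {linear g -> X}) (j : {linear h -> X}).
Variables (p : {linear X -> g}) (q : {linear X -> h}).
Hypotheses (iM : leibniz_morph i) (jM : leibniz_morph j).
Hypotheses (iK : cancel i p) (jK : cancel j q).
Hypothesis decomp : forall z, i (p z) + j (q z) = z.

(** [decomp] at [j x] leaves [i (p (j x)) = 0], and [p] cancels [i]. *)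
Let pj x : p (j x) = 0.
Proof.
have := decomp (j x); rewrite jK => /(canRL (addrK _)); rewrite subrr => E.
by rewrite -[LHS]iK E linear0.
Qed.

Let qi a : q (i a) = 0.
Proof.
have := decomp (i a); rewrite iK addrC => /(canRL (addrK _)); rewrite subrr => E.
by rewrite -[LHS]jK E linear0.
Qed.

(** In this and the next seven rules one argument lies in the copy named by [i] or [j], on the side
    named by [l] or [r]. The other is split by [decomp]; the bracket inside one copy stays there, so
    a projection either recovers it or kills it. *)
Let p_il a z : p ⟦i a, z⟧ = ⟦a, p z⟧ + p ⟦i a, j (q z)⟧.
Proof. by rewrite -{1}[z]decomp bracketDr -iM linearD iK. Qed.

Let q_il a z : q ⟦i a, z⟧ = q ⟦i a, j (q z)⟧.
Proof. by rewrite -{1}[z]decomp bracketDr -iM linearD qi add0r. Qed.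

Let p_jl x z : p ⟦j x, z⟧ = p ⟦j x, i (p z)⟧.
Proof. by rewrite -{1}[z]decomp bracketDr -jM linearD pj addr0. Qed.

Let q_jl x z : q ⟦j x, z⟧ = q ⟦j x, i (p z)⟧ + ⟦x, q z⟧.
Proof. by rewrite -{1}[z]decomp bracketDr -jM linearD jK. Qed.

Let p_ir z a : p ⟦z, i a⟧ = ⟦p z, a⟧ + p ⟦j (q z), i a⟧.
Proof. by rewrite -{1}[z]decomp bracketDl -iM linearD iK. Qed.

Let q_ir z a : q ⟦z, i a⟧ = q ⟦j (q z), i a⟧.
Proof. by rewrite -{1}[z]decomp bracketDl -iM linearD qi add0r. Qed.

Let p_jr z x : p ⟦z, j x⟧ = p ⟦i (p z), j x⟧.
Proof. by rewrite -{1}[z]decomp bracketDl -jM linearD pj addr0. Qed.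

Let q_jr z x : q ⟦z, j x⟧ = q ⟦i (p z), j x⟧ + ⟦q z, x⟧.
Proof. by rewrite -{1}[z]decomp bracketDl -jM linearD jK. Qed.

(** Keeping the embeddings and the projection as parameters covers the four actions with a single
    bilinearity proof. *)
Definition component (A B C : leibnizType k) (f : {linear A -> X})
    (f' : {linear B -> X}) (r : {linear X -> C}) (a : A) (b : B) : C :=
  r ⟦f a, f' b⟧.

Lemma component_bilinear (A B C : leibnizType k) (f : {linear A -> X})
    (f' : {linear B -> X}) (r : {linear X -> C}) :
  bilinear_for *:%R *:%R (component f f' r).
Proof.
by split=> [b|a] c u v; rewrite /component linearP ?linearPl ?linearPr linearP.
Qed.

HB.instance Definition _ (A B C : leibnizType k) (f : {linear A -> X})
    (f' : {linear B -> X}) (r : {linear X -> C}) :=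
  bilinear_isBilinear.Build k A B C *:%R *:%R (component f f' r)
    (component_bilinear f f' r).

(** (MP1)-(MP3) and (MP8) project the Leibniz identity itself, (MP4)-(MP7) its form
    [bracket_bracketl], and (MP9)-(MP12) [bracket_anti_r]. Each triple of arguments is projected by
    both [p] and [q]. *)
Lemma component_matched_pair :
  matched_pair_identities (component j i q) (component j i p)
    (component i j p) (component i j q).
Proof.
split=> [a b x|a x y|a b x|a x y|a x y|a b x|a b x|a x y|a b x|a x y|a x y|a b x];
  rewrite /= /component.
- by rewrite iM bracket_leibniz linearB ![q ⟦⟦_, _⟧, i _⟧]q_ir.
- by rewrite jM bracket_leibniz linearB ![p ⟦⟦_, _⟧, j _⟧]p_jr.
- rewrite iM bracket_leibniz linearB ![p ⟦⟦_, _⟧, i _⟧]p_ir.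
  by rewrite opprD addrACA addrA.
- rewrite jM bracket_bracketl linearD [q ⟦_, ⟦_, _⟧⟧]q_jl [q ⟦⟦_, _⟧, _⟧]q_jr.
  by rewrite addrACA addrA.
- by rewrite jM bracket_bracketl linearD [p ⟦_, ⟦_, _⟧⟧]p_jl [p ⟦⟦_, _⟧, _⟧]p_jr.
- rewrite iM bracket_bracketl linearD [p ⟦_, ⟦_, _⟧⟧]p_il [p ⟦⟦_, _⟧, _⟧]p_ir.
  by rewrite addrACA addrA.
- by rewrite iM bracket_bracketl linearD [q ⟦_, ⟦_, _⟧⟧]q_il [q ⟦⟦_, _⟧, _⟧]q_ir.
- rewrite jM bracket_leibniz linearB ![q ⟦⟦_, _⟧, j _⟧]q_jr.
  by rewrite opprD addrACA addrA.
- have := congr1 p (bracket_anti_r (i a) (i b) (j x)).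
  by rewrite linearD linear0 ![p ⟦_, ⟦_, _⟧⟧]p_il addrACA addrA.
- have := congr1 p (bracket_anti_r (j x) (j y) (i a)).
  by rewrite linearD linear0 ![p ⟦_, ⟦_, _⟧⟧]p_jl.
- have := congr1 q (bracket_anti_r (j x) (j y) (i a)).
  by rewrite linearD linear0 ![q ⟦_, ⟦_, _⟧⟧]q_jl addrACA addrA.
- have := congr1 q (bracket_anti_r (i a) (i b) (j x)).
  by rewrite linearD linear0 ![q ⟦_, ⟦_, _⟧⟧]q_il.
Qed.

Let M : matched_pair g h := MatchedPair component_matched_pair.

Let pq (z : X) : bicrossed M := (p z, q z).

Let pq_linear : linear pq.
Proof. by move=> c u v; congr pair; rewrite linearP. Qed.

HB.instance Definition _ :=
  GRing.isLinear.Build k X (bicrossed M) *:%R pq pq_linear.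

Lemma decomposition_bicrossed :
  exists M : matched_pair g h, leibniz_iso X (bicrossed M).
Proof.
exists M, pq; split=> [u v|]; last first.
  exists (fun z : bicrossed M => i z.1 + j z.2) => [z|[a x]]; first exact: decomp.
  by congr pair; rewrite /= linearD ?iK ?jK ?pj ?qi ?addr0 ?add0r.
(* Of the four brackets obtained, the two within one copy are handled by [iM] and [jM]; the mixed
   ones are the actions by definition. Only the order of summands then differs. *)
rewrite -{1}[u]decomp -{1}[v]decomp; congr pair => /=; rewrite /component.
  rewrite !(bracketDl, bracketDr) -iM -jM !linearD iK pj addr0.
  exact: addrAC.
rewrite !(bracketDl, bracketDr) -iM -jM !linearD jK qi add0r.
by rewrite [LHS]addrC; congr (_ + _); apply: addrC.
Qed.

End Decomposition.

(** The sum map on [g * h] is a linear bijection onto [X]; the components of its inverse are the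
    projections of the decomposition. *)
Lemma factorizes_through_bicrossed (k : fieldType) (g h X : leibnizType k) :
  factorizes_through X g h ->
  exists M : matched_pair g h, leibniz_iso X (bicrossed M).
Proof.
case=> G [H [[_ [i [iM i_inj GP]]] [_ [j [jM j_inj HP]]] GH_span GH0]].
pose f (u : g * h) : X := i u.1 + j u.2.
have f_lin : linear f.
  by move=> c u v; rewrite /f !linearP scalerDr addrACA.
pose fM := GRing.isLinear.Build k (g * h)%type X *:%R f f_lin.
pose fL : {linear (g * h)%type -> X} := HB.pack f fM.
have f_inj : injective f.
  move=> [a x] [b y] /eqP; rewrite /f /= -subr_eq0 opprD addrACA -!linearB.
  rewrite addr_eq0 -linearN => /eqP E.
  (* By [E] this element lies in both copies, whose intersection is zero. *)
  have E0 : i (a - b) = 0.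
    by apply/GH0; split; [apply/GP; exists (a - b) | rewrite E; apply/HP; eexists].
  have /eqP := E0; rewrite -(linear0 i) => /eqP/i_inj/eqP.
  move: E; rewrite E0 -(linear0 j) => /j_inj/esym/eqP; rewrite oppr_eq0.
  by rewrite !subr_eq0 => /eqP -> /eqP ->.
(* The boolean equality lets [xchoose] extract a preimage, hence an inverse function. *)
have f_surj z : exists u, f u == z.
  have [_ [_ [/GP[a <-] /HP[x <-] ->]]] := GH_span z.
  by exists (a, x).
have f_bij : bijective fL.
  exists (fun z => xchoose (f_surj z)) => [u|z]; last exact/eqP/(xchooseP (f_surj z)).
  exact/f_inj/eqP/(xchooseP (f_surj (f u))).
have [e [fK eK]] := bijective_linear_inv f_bij.
have p_lin : linear (fst \o e) by move=> c u v; rewrite /= linearP.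
have q_lin : linear (snd \o e) by move=> c u v; rewrite /= linearP.
pose pM := GRing.isLinear.Build k X g *:%R (fst \o e) p_lin.
pose qM := GRing.isLinear.Build k X h *:%R (snd \o e) q_lin.
pose p : {linear X -> g} := HB.pack (fst \o e) pM.
pose q : {linear X -> h} := HB.pack (snd \o e) qM.
apply: (@decomposition_bicrossed k g h X i j p q iM jM) => [a|x|z].
- by have := fK (a, 0); rewrite /= /f /= linear0 addr0 => ->.
- by have := fK (0, x); rewrite /= /f /= linear0 add0r => ->.
- exact: eK.
Qed.

(** * The two factors inside a bicrossed product, and the converse *)

Section BicrossedFactors.
Variables (k : fieldType) (g h : leibnizType k) (M : matched_pair g h).

Definition bicrossed_inl (a : g) : bicrossed M := (a, 0).
Definition bicrossed_inr (x : h) : bicrossed M := (0, x).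

Lemma bicrossed_inl_linear : linear bicrossed_inl.
Proof. by move=> c a b; congr pair; rewrite /= scaler0 addr0. Qed.

Lemma bicrossed_inr_linear : linear bicrossed_inr.
Proof. by move=> c a b; congr pair; rewrite /= scaler0 addr0. Qed.

HB.instance Definition _ :=
  GRing.isLinear.Build k g (bicrossed M) *:%R bicrossed_inl bicrossed_inl_linear.
HB.instance Definition _ :=
  GRing.isLinear.Build k h (bicrossed M) *:%R bicrossed_inr bicrossed_inr_linear.

(** Every action here has a zero argument, so only the bracket of [g] survives. *)
Lemma bicrossed_inl_morph : leibniz_morph bicrossed_inl.
Proof.
by move=> a b; congr pair; rewrite /= !(linear0l, linear0r) ?addr0.
Qed.

Lemma bicrossed_inr_morph : leibniz_morph bicrossed_inr.
Proof.
by move=> a b; congr pair; rewrite /= !(linear0l, linear0r) ?addr0.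
Qed.

End BicrossedFactors.

Lemma leibniz_morph_inv (k : fieldType) (A B : leibnizType k) (f : A -> B) e :
  cancel f e -> cancel e f -> leibniz_morph f -> leibniz_morph e.
Proof. by move=> fK eK fM u v; apply: (can_inj fK); rewrite fM !eK. Qed.

Lemma isomorphic_copy_subalgebra (k : fieldType) (A X : leibnizType k)
    (S : {pred X}) :
  isomorphic_copy A S -> leibniz_subalgebra S.
Proof.
case=> f [fM _ SP]; split; first split.
- by apply/SP; exists 0; rewrite linear0.
- move=> c u v /SP[a <-] /SP[b <-]; apply/SP; exists (c *: a + b).
  exact: linearP.
- by move=> u v /SP[a <-] /SP[b <-]; apply/SP; exists ⟦a, b⟧.
Qed.

Lemma bicrossed_factorizes_through (k : fieldType) (g h X : leibnizType k)
    (M : matched_pair g h) :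
  leibniz_iso X (bicrossed M) -> factorizes_through X g h.
Proof.
case=> f [fM /bijective_linear_inv[e [fK eK]]].
have eM := leibniz_morph_inv fK eK fM.
(* [G] and [H] are the preimages under [f] of the two factors, each cut out by the vanishing of the
   opposite component. *)
pose G : {pred X} := [pred z | (f z).2 == 0].
pose H : {pred X} := [pred z | (f z).1 == 0].
have Gg : isomorphic_copy g G.
  exists (e \o @bicrossed_inl k g h M); split=> [a b|a b|z] /=.
  - by rewrite bicrossed_inl_morph eM.
  - by move/(can_inj eK) => [].
  - rewrite inE; split=> [/eqP E|[a <-]]; last by rewrite eK.
    exists (f z).1; rewrite -[RHS]fK; congr (e _).
    by rewrite /bicrossed_inl -E; case: (f z).
have Hh : isomorphic_copy h H.
  exists (e \o @bicrossed_inr k g h M); split=> [a b|a b|z] /=.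
  - by rewrite bicrossed_inr_morph eM.
  - by move/(can_inj eK) => [].
  - rewrite inE; split=> [/eqP E|[a <-]]; last by rewrite eK.
    exists (f z).2; rewrite -[RHS]fK; congr (e _).
    by rewrite /bicrossed_inr -E; case: (f z).
exists G, H; split; [| |move=> z|move=> z].
- by split; first exact: isomorphic_copy_subalgebra Gg.
- by split; first exact: isomorphic_copy_subalgebra Hh.
(* The splitting of [f z] into its components is carried back to [X] by [e]. *)
- exists (e (bicrossed_inl M (f z).1)), (e (bicrossed_inr M (f z).2)).
  split; rewrite ?inE ?eK //= -linearD -[LHS]fK; congr (e _).
  by case: (f z) => a x; congr pair; rewrite /= ?addr0 ?add0r.
- rewrite !inE; split=> [[/eqP E2 /eqP E1]|->]; last by rewrite linear0.
  apply: (can_inj fK); rewrite linear0.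
  by case: (f z) E1 E2 => a x /= -> ->.
Qed.

Theorem corollary4p6 (k : fieldType) (g h Xi : leibnizType k) :
  factorizes_through Xi g h <->
  exists M : matched_pair g h, leibniz_iso Xi (bicrossed M).
Proof.
split; first exact: factorizes_through_bicrossed.
by case=> M; apply: bicrossed_factorizes_through.
Qed.
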